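(* Let $p$ be an odd prime, $\mathcal O$ a complete discrete valuation ring with maximal ideal generated by $p$ and perfect residue field, $\delta$ its unique $p$-derivation, $n\ge1$, and let $q_1,\dots,q_n\in GL_n(\mathcal O)$, $q_i=(q_{ijk})_{j,k}$, be symmetric matrices. Let $(\delta_1^G,\dots,\delta_n^G)$ be the Levi-Civita connection on $G=GL_n$ over $\mathcal O$ attached to $(q_1,\dots,q_n)$, with Christoffel symbols $\Gamma_i=(\Gamma_{ijk})$. Let $$C_i=(C_{ijk})_{j,k}:=-x^{(p)t}\cdot\delta q_i\cdot x^{(p)}+\frac1p\left\{(x^tq_ix)^{(p)}-x^{(p)t}q_i^{(p)}x^{(p)}\right\}.$$ Then for all $i,j,k$ the following congruences hold in $\mathcal O(\widehat G)$: $$\Gamma_{ijk}\equiv\tfrac12(C_{ijk}+C_{jik}-C_{kij})\quad\text{mod }p,$$ $$\Gamma_{ijk}\equiv-\tfrac12(\delta q_{ijk}+\delta q_{jik}-\delta q_{kij})\quad\text{mod }(p,x-1),$$ where $(p,x-1)$ is the ideal generated by $p$, the $x_{ii}-1$, and the $x_{ij}$ for $i\neq j$.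
   Context: For a matrix $a=(a_{ij})$, $a^t$ is the transpose and $a^{(p)}=(a_{ij}^p)$; set maps between rings are applied to matrices entrywise. A Frobenius lift on a ring $A$ is a ring endomorphism reducing mod $p$ to the $p$-power Frobenius of $A/pA$. On a $p$-torsion free ring a $p$-derivation $\delta$ is the same as a Frobenius lift $\phi$, via $\phi(a)=a^p+p\,\delta a$ (''attached''). $\mathcal O$ has a unique Frobenius lift $\phi$, hence a unique $p$-derivation $\delta$. Let $x$ be an $n\times n$ matrix of indeterminates, $G=\mathrm{Spec}\,\mathcal O[x,\det(x)^{-1}]$, $\mathcal O(\widehat G)$ the $p$-adic completion of $\mathcal O[x,\det(x)^{-1}]$. A $p$-adic connection on $G$ is a $p$-derivation $\delta^G$ on $\mathcal O(\widehat G)$ extending $\delta$, with attached Frobenius lift $\phi^G$. It is metric with respect to a symmetric $q\in GL_n(\mathcal O)$ if $\phi^G\circ\mathcal H_q=\mathcal H_q\circ\phi_0^G$, where $\mathcal H_q$ is the (continuous) $\mathcal O$-algebra endomorphism of $\mathcal O(\widehat G)$ with $x\mapsto x^tqx$ and $\phi_0^G$ is the Frobenius lift extending $\phi$ with $\phi_0^G(x)=x^{(p)}$. The Christoffel symbols of an $n$-tuple $(\delta_1^G,\dots,\delta_n^G)$ with respect to $(q_1,\dots,q_n)$ are $\Gamma_i=(\Gamma_{ijk})_{j,k}:=(\delta_i^Gx)^t\cdot\phi(q_i)\cdot x^{(p)}$. The Levi-Civita connection attached to $(q_1,\dots,q_n)$ is the unique (it exists) $n$-tuple of $p$-adic connections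 such that $\delta_i^G$ is metric with respect to $q_i$ for all $i$ and $\Gamma_{ijk}=\Gamma_{jik}$ for all $i,j,k$. *)

(* Defs.v *)
From HB Require Import structures.
From mathcomp Require Import all_boot all_order all_algebra.
From mathcomp Require Import boolp classical_sets functions.
From mathcomp Require Import mpoly.

Set Implicit Arguments.
Unset Strict Implicit.
Unset Printing Implicit Defensive.

Import GRing.Theory.
Import generic_quotient.

Local Open Scope ring_scope.

Definition congr_mod (R : pzRingType) (d a b : R) : Prop :=
  exists c, a - b = d * c.

Section CongrModTheory.
Variables (R : comPzRingType) (d : R).

Lemma congr_mod_refl (a : R) : congr_mod d a a.
Proof. by exists 0; rewrite subrr mulr0. Qed.

Lemma congr_modB (a b a' b' : R) :
  congr_mod d a b -> congr_mod d a' b' -> congr_mod d (a - a') (b - b').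
Proof.
move=> [c e] [c' e']; exists (c - c').
by rewrite mulrBr -e -e' !opprD !opprK addrACA.
Qed.

Lemma congr_modM (a b a' b' : R) :
  congr_mod d a b -> congr_mod d a' b' -> congr_mod d (a * a') (b * b').
Proof.
move=> [c e] [c' e']; exists (c * a' + b * c').
rewrite mulrDr mulrA -e mulrCA -e' mulrBl mulrBr addrA.
by rewrite subrK.
Qed.

End CongrModTheory.

(* The p-adic completion, i.e. the limit of the rings R / p^m R. A compatible
   family is represented by a sequence u with u (m + 1) = u m modulo p^m, and
   two sequences are identified when they agree modulo p^m at each index m. *)
Section Completion.
Variables (R : comPzRingType) (p : nat).

Definition compatible : {pred nat -> R} :=
  fun u => `[< forall m, congr_mod (p%:R ^+ m) (u m.+1) (u m) >].

Lemma compatible_subring_closed : subring_closed compatible.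
Proof.
split.
- by apply/asboolP => m; apply: congr_mod_refl.
- move=> u v /asboolP hu /asboolP hv; apply/asboolP => m.
  exact: congr_modB.
- move=> u v /asboolP hu /asboolP hv; apply/asboolP => m.
  exact: congr_modM.
Qed.

HB.instance Definition _ :=
  GRing.isSubringClosed.Build (nat -> R) compatible compatible_subring_closed.

Record compatible_seq := CompatibleSeq {
  seq_of : nat -> R;
  _ : seq_of \in compatible }.

HB.instance Definition _ := [isSub for seq_of].
HB.instance Definition _ := [Choice of compatible_seq by <:].
HB.instance Definition _ := GRing.SubChoice_isSubComPzRing.Build
  (nat -> R) compatible compatible_seq compatible_subring_closed.

Definition null_seq : {pred compatible_seq} :=
  fun u => `[< forall m, congr_mod (p%:R ^+ m) (seq_of u m) 0 >].

Lemma null_seq_zmod_closed : zmod_closed null_seq.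
Proof.
split; first by apply/asboolP => m; apply: congr_mod_refl.
move=> u v /asboolP hu /asboolP hv; apply/asboolP => m.
by rewrite -(subr0 0); apply: congr_modB.
Qed.

HB.instance Definition _ :=
  GRing.isZmodClosed.Build compatible_seq null_seq null_seq_zmod_closed.

Lemma null_seqMl (u v : compatible_seq) :
  v \in null_seq -> u * v \in null_seq.
Proof.
move=> /asboolP hv; apply/asboolP => m.
rewrite -(mulr0 (seq_of u m)); apply: congr_modM => //.
exact: congr_mod_refl.
Qed.

Definition completion := Quotient.quot null_seq.

HB.instance Definition _ := GRing.Zmodule.on completion.

Definition completion_pi (u : compatible_seq) : completion :=
  \pi_(Quotient.quot null_seq)%qT u.

Definition completion_repr (a : completion) : compatible_seq :=
  @repr _ (Quotient.quot null_seq) a.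

Lemma completion_reprK : cancel completion_repr completion_pi.
Proof. by move=> a; rewrite /completion_pi /completion_repr reprK. Qed.

Lemma completion_piP (u v : compatible_seq) :
  completion_pi u = completion_pi v <-> u - v \in null_seq.
Proof.
rewrite Quotient.idealrBE; split=> [e | /eqP //].
by apply/eqP; exact: e.
Qed.

Lemma completion_piB : zmod_morphism completion_pi.
Proof.
move=> u v; exact: (raddfB (\pi_(Quotient.quot null_seq)%qT)).
Qed.

HB.instance Definition _ := GRing.isZmodMorphism.Build compatible_seq completion
  completion_pi completion_piB.

Definition completion_mul (a b : completion) : completion :=
  completion_pi (completion_repr a * completion_repr b).

Lemma completion_piM (u v : compatible_seq) :
  completion_mul (completion_pi u) (completion_pi v) = completion_pi (u * v).
Proof.
rewrite /completion_mul.
set u' := completion_repr _; set v' := completion_repr _.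
have hu : u' - u \in null_seq by apply/completion_piP; rewrite completion_reprK.
have hv : v' - v \in null_seq by apply/completion_piP; rewrite completion_reprK.
apply/completion_piP.
have -> : u' * v' - u * v = v' * (u' - u) + u * (v' - v).
  by rewrite !mulrBr [v' * u']mulrC [v' * u]mulrC addrA subrK.
by apply: rpredD; apply: null_seqMl.
Qed.

Lemma completion_mulA : associative completion_mul.
Proof.
move=> a b c; rewrite -[a]completion_reprK -[b]completion_reprK.
by rewrite -[c]completion_reprK !completion_piM mulrA.
Qed.

Lemma completion_mulC : commutative completion_mul.
Proof. by move=> a b; rewrite /completion_mul mulrC. Qed.

Lemma completion_mul1 : left_id (completion_pi 1) completion_mul.
Proof. by move=> a; rewrite -[a]completion_reprK completion_piM mul1r. Qed.

Lemma completion_mulDl : left_distributive completion_mul +%R.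
Proof.
move=> a b c; rewrite -[a]completion_reprK -[b]completion_reprK.
rewrite -[c]completion_reprK -raddfD !completion_piM mulrDl.
exact: raddfD.
Qed.

HB.instance Definition _ := GRing.Zmodule_isComPzRing.Build completion
  completion_mulA completion_mulC completion_mul1 completion_mulDl.

Lemma cst_compatible (r : R) : (fun=> r) \in compatible.
Proof. by apply/asboolP => m; apply: congr_mod_refl. Qed.

Definition to_completion (r : R) : completion :=
  completion_pi (CompatibleSeq (cst_compatible r)).

Lemma to_completion_is_zmod_morphism : zmod_morphism to_completion.
Proof.
move=> r s; rewrite /to_completion -raddfB.
by congr completion_pi; apply/val_inj.
Qed.

Lemma to_completion_is_monoid_morphism : monoid_morphism to_completion.
Proof.
split; first by congr completion_pi; apply/val_inj.
move=> r s; rewrite /to_completion [RHS]completion_piM.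
by congr completion_pi; apply/val_inj.
Qed.

HB.instance Definition _ := GRing.isZmodMorphism.Build R completion
  to_completion to_completion_is_zmod_morphism.
HB.instance Definition _ := GRing.isMonoidMorphism.Build R completion
  to_completion to_completion_is_monoid_morphism.

End Completion.

(* The ring O[x, det(x)^-1], as the subring of fractions f / det(x)^k in the
   fraction field of O[x]; the entry (i, j) of x is the variable of index
   [mxvec_index i j] among the n * n variables. *)
Section CoordinateRing.
Variables (O : idomainType) (n : nat).

Local Notation polyring := {mpoly O[n * n]}.

Definition generic_poly_mx : 'M[polyring]_n :=
  \matrix_(i, j) 'X_(mxvec_index i j).

Definition in_GLring : {pred {fraction polyring}} := fun z =>
  `[< exists (f : polyring) (k : nat),
        z = tofrac f / tofrac (\det generic_poly_mx) ^+ k >].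

Lemma det_generic_poly_mx_neq0 : \det generic_poly_mx != 0.
Proof.
pose v (l : 'I_(n * n)) : O :=
  (1%:M : 'M[O]_n) (enum_val (cast_ord (esym (mxvec_cast n n)) l)).1
                   (enum_val (cast_ord (esym (mxvec_cast n n)) l)).2.
have e : map_mx (meval v) generic_poly_mx = 1%:M.
  apply/matrixP => i j; rewrite !mxE mevalXU /v /mxvec_index.
  by rewrite cast_ordK enum_rankK mxE.
apply: contraTneq (oner_neq0 O) => d0.
by rewrite -(det1 O n) -e det_map_mx d0 rmorph0 eqxx.
Qed.

Lemma in_GLring_subring_closed : subring_closed in_GLring.
Proof.
set D := tofrac (\det generic_poly_mx).
have D0 : D != 0 by rewrite tofrac_eq0 det_generic_poly_mx_neq0.
split.
- by apply/asboolP; exists 1, 0%N; rewrite rmorph1 expr0 divr1.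
- move=> _ _ /asboolP[f [k ->]] /asboolP[g [l ->]]; apply/asboolP.
  exists (f * \det generic_poly_mx ^+ l - g * \det generic_poly_mx ^+ k).
  exists (k + l)%N; rewrite rmorphB !rmorphM !rmorphXn /= -/D exprD mulrBl.
  rewrite invfM !mulrA; congr (_ - _).
    by rewrite mulrAC mulfK ?expf_neq0.
  by rewrite mulfK ?expf_neq0.
- move=> _ _ /asboolP[f [k ->]] /asboolP[g [l ->]]; apply/asboolP.
  exists (f * g), (k + l)%N.
  by rewrite rmorphM /= -/D exprD invfM mulrACA.
Qed.

Record GLring := MkGLring {
  fraction_of_GLring : {fraction polyring};
  _ : fraction_of_GLring \in in_GLring }.

HB.instance Definition _ := [isSub for fraction_of_GLring].
HB.instance Definition _ := [Choice of GLring by <:].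
HB.instance Definition _ := GRing.SubChoice_isSubComNzRing.Build
  {fraction polyring} in_GLring GLring in_GLring_subring_closed.

Lemma tofrac_in_GLring (f : polyring) : tofrac f \in in_GLring.
Proof. by apply/asboolP; exists f, 0%N; rewrite expr0 divr1. Qed.

Definition poly_to_GLring (f : polyring) : GLring :=
  MkGLring (tofrac_in_GLring f).

Lemma poly_to_GLring_is_zmod_morphism : zmod_morphism poly_to_GLring.
Proof. by move=> f g; apply/val_inj; rewrite /= rmorphB. Qed.

Lemma poly_to_GLring_is_monoid_morphism : monoid_morphism poly_to_GLring.
Proof.
by split=> [|f g]; apply/val_inj; rewrite /= (rmorph1, rmorphM).
Qed.

HB.instance Definition _ := GRing.isZmodMorphism.Build polyring GLring
  poly_to_GLring poly_to_GLring_is_zmod_morphism.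
HB.instance Definition _ := GRing.isMonoidMorphism.Build polyring GLring
  poly_to_GLring poly_to_GLring_is_monoid_morphism.

End CoordinateRing.

Section CompletedGroup.
Variables (O : idomainType) (p n : nat).

Definition GLhat : comPzRingType := completion (GLring O n) p.

Definition poly_to_GLhat : {mpoly O[n * n]} -> GLhat :=
  to_completion p \o @poly_to_GLring O n.

HB.instance Definition _ := GRing.RMorphism.on poly_to_GLhat.

Definition cstG : O -> GLhat := poly_to_GLhat \o @mpolyC (n * n) O.

HB.instance Definition _ := GRing.RMorphism.on cstG.

Definition xG : 'M[GLhat]_n := map_mx poly_to_GLhat (generic_poly_mx O n).

End CompletedGroup.

Section CompleteDVR.
Variable O : comPzRingType.

Definition is_ideal (I : O -> Prop) : Prop :=
  [/\ I 0, forall a b, I a -> I b -> I (a + b) & forall a b, I b -> I (a * b)].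

Definition principal_ideal (a : O) : O -> Prop := fun b => exists c, b = c * a.

Definition is_maximal_ideal (M : O -> Prop) : Prop :=
  [/\ is_ideal M, ~ M 1 &
      forall I, is_ideal I -> ~ I 1 -> (forall a, M a -> I a) ->
        forall a, I a -> M a].

(* For an integral domain: O is a principal ideal domain, not a field, whose
   only maximal ideal is the one generated by a. *)
Definition is_DVR_with_maximal_ideal (a : O) : Prop :=
  [/\ forall I, is_ideal I ->
        exists b, forall c, I c <-> principal_ideal b c,
      a <> 0,
      is_maximal_ideal (principal_ideal a) &
      forall M, is_maximal_ideal M ->
        forall c, M c <-> principal_ideal a c].

Definition is_adically_complete (a : O) : Prop :=
  (forall b, (forall m, congr_mod (a ^+ m) b 0) -> b = 0) /\
  (forall u : nat -> O,
     (forall m, exists N, forall i j, (N <= i)%N -> (N <= j)%N ->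
        congr_mod (a ^+ m) (u i) (u j)) ->
     exists l, forall m, exists N, forall i, (N <= i)%N ->
        congr_mod (a ^+ m) (u i) l).

(* Perfectness of O / (p), a field of characteristic p: its Frobenius
   b |-> b ^+ p is surjective (it is injective on any field). *)
Definition has_perfect_residue_field (p : nat) : Prop :=
  forall a : O, exists b, congr_mod p%:R a (b ^+ p).

End CompleteDVR.

Section PDerivations.
Variables (R : comPzRingType) (p : nat).

Definition is_frobenius_lift (phi : R -> R) : Prop :=
  [/\ zmod_morphism phi, monoid_morphism phi &
      forall a, congr_mod p%:R (phi a) (a ^+ p)].

Definition attached (delta : R -> R) : R -> R :=
  fun a => a ^+ p + p%:R * delta a.

Definition is_p_derivation (delta : R -> R) : Prop :=
  is_frobenius_lift (attached delta).

Definition is_padic_continuous (f : R -> R) : Prop :=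
  forall a m, exists k, forall b,
    congr_mod (p%:R ^+ k) b a -> congr_mod (p%:R ^+ m) (f b) (f a).

(* b / p; meaningful when R is p-torsion free and p divides b, and 0 by
   convention when p does not divide b. *)
Definition divide_by_p (b : R) : R :=
  if pselect (exists c, p%:R * c = b) is left h then projT1 (cid h) else 0.

Definition frobmx n (a : 'M[R]_n) : 'M[R]_n := map_mx (fun b => b ^+ p) a.

End PDerivations.

Section Connections.
Variables (O : idomainType) (p n : nat).
Variable delta : O -> O.

Local Notation A := (GLhat O p n).
Local Notation x := (xG O p n).
Local Notation cst := (@cstG O p n).
Local Notation "a ^(p)" := (frobmx p a) (at level 2, format "a ^(p)").
Local Notation phi := (attached p delta).

Definition is_padic_connection (deltaG : A -> A) : Prop :=
  is_p_derivation p deltaG /\ forall a, deltaG (cst a) = cst (delta a).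

Definition is_calH (q : 'M[O]_n) (H : A -> A) : Prop :=
  [/\ zmod_morphism H /\ monoid_morphism H,
      forall a, H (cst a) = cst a,
      is_padic_continuous p H &
      map_mx H x = x^T *m map_mx cst q *m x].

Definition is_phi0 (phi0 : A -> A) : Prop :=
  [/\ is_frobenius_lift p phi0,
      forall a, phi0 (cst a) = cst (phi a) &
      map_mx phi0 x = x^(p)].

(* [is_calH q] and [is_phi0] each determine a unique map. *)
Definition is_metric (q : 'M[O]_n) (deltaG : A -> A) : Prop :=
  exists H phi0 : A -> A,
    [/\ is_calH q H, is_phi0 phi0 &
        attached p deltaG \o H =1 H \o phi0].

Definition christoffel (q : 'M[O]_n) (deltaG : A -> A) : 'M[A]_n :=
  (map_mx deltaG x)^T *m map_mx (cst \o phi) q *m x^(p).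

Definition is_levi_civita (q : 'I_n -> 'M[O]_n) (deltaG : 'I_n -> A -> A) :
    Prop :=
  [/\ forall i, is_padic_connection (deltaG i),
      forall i, is_metric (q i) (deltaG i) &
      forall i j k, christoffel (q i) (deltaG i) j k
                    = christoffel (q j) (deltaG j) i k].

Definition Cmx (q : 'M[O]_n) : 'M[A]_n :=
  - (x^(p)^T *m map_mx (cst \o delta) q *m x^(p))
  + map_mx (divide_by_p p)
      ((x^T *m map_mx cst q *m x)^(p)
       - x^(p)^T *m (map_mx cst q)^(p) *m x^(p)).

(* Congruence modulo the ideal generated by p and the entries of x - 1. *)
Definition congr_mod_p_x1 (a b : A) : Prop :=
  exists (c : A) (d : 'M[A]_n),
    a - b = p%:R * c + \sum_i \sum_j d i j * (x - 1%:M) i j.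

End Connections.

(* Main.v *)
Require Import Defs.
From HB Require Import structures.
From mathcomp Require Import all_boot all_order all_algebra.
From mathcomp Require Import boolp functions mpoly.
From mathcomp Require Import ring.
Set Implicit Arguments.
Unset Strict Implicit.
Import GRing.Theory.
Local Open Scope ring_scope.

(** Write F = x^(p) and D = (delta_i x), so that phi_i(x) = F + p D.  Evaluated
    at x, the metric condition reads
    phi_i(x)^T phi(q_i) phi_i(x) = (x^T q_i x)^(p).  Expanding, and dividing by
    p in the p-torsion free ring O(G^), gives
    Gamma_i + Gamma_i^T + p D^T phi(q_i) D = C_i.  Modulo p this expresses the
    C_ijk through the Gamma_ijk, and the symmetry Gamma_ijk = Gamma_jik inverts
    the relation as for the classical Christoffel symbols.  For the second
    congruence, C_i is the image of a matrix of polynomials whose value at x = 1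
    is - delta q_i, the bracket in C_i vanishing there. *)

(** * The p-power map on sums and matrix products, modulo p *)

Section FrobeniusModP.
Variables (R : comPzRingType) (p : nat).
Hypothesis p_pr : prime p.

Lemma frobenius_congrD (a b : R) :
  congr_mod p%:R ((a + b) ^+ p) (a ^+ p + b ^+ p).
Proof.
have pE : p = p.-1.+1 by rewrite prednK ?prime_gt0.
(* The interior binomial terms, of index [i.+1] from 1 to p - 1, with the factor p taken out of each
   coefficient. *)
exists (\sum_(i < p.-1) (a ^+ (p - i.+1) * b ^+ i.+1) *+ ('C(p, i.+1) %/ p)).
rewrite mulr_sumr.
under [RHS]eq_bigr => i _.
  rewrite mulr_natl -mulrnA divnK; last first.
    by apply: prime_dvd_bin => //=; rewrite [ltnRHS]pE ltnS ltn_ord.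
  over.
have splitE (F : nat -> R) :
    \sum_(i < p.+1) F i = F 0%N + F p + \sum_(i < p.-1) F i.+1.
  rewrite [in LHS]pE big_ord_recl big_ord_recr /= /bump /= !add1n -pE.
  by rewrite addrA addrAC.
rewrite exprDn (splitE (fun i => (a ^+ (p - i) * b ^+ i) *+ 'C(p, i))).
by rewrite subn0 subnn bin0 binn !expr0 mulr1 mul1r !mulr1n addrC addKr.
Qed.

Lemma frobenius_congr_sum (I : Type) (r : seq I) (F : I -> R) :
  congr_mod p%:R ((\sum_(i <- r) F i) ^+ p) (\sum_(i <- r) F i ^+ p).
Proof.
elim: r => [|i r [c e]].
  by rewrite !big_nil expr0n -(prednK (prime_gt0 p_pr)); apply: congr_mod_refl.
rewrite !big_cons.
have [c' e'] := frobenius_congrD (F i) (\sum_(j <- r) F j).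
exists (c' + c); rewrite mulrDr -e -e'; ring.
Qed.

Lemma frobmx_mul n (a b : 'M[R]_n) :
  exists c, frobmx p (a *m b) = frobmx p a *m frobmx p b + p%:R *: c.
Proof.
have h (ij : 'I_n * 'I_n) : exists c,
    frobmx p (a *m b) ij.1 ij.2 - (frobmx p a *m frobmx p b) ij.1 ij.2
    = p%:R * c.
  rewrite !mxE; have [c e] := frobenius_congr_sum (index_enum 'I_n)
    (fun k => a ij.1 k * b k ij.2).
  by exists c; rewrite -e; congr (_ - _); apply: eq_bigr => k _;
     rewrite !mxE exprMn.
have [c hc] := choice h.
exists (\matrix_(i, j) c (i, j)); apply/matrixP => i j.
by rewrite [RHS]mxE [X in _ + X]mxE [in X in _ + _ * X]mxE -hc addrC subrK.
Qed.

(** Exhibits the bracket in C_i as p times an explicit matrix, so that [divide_by_p] never takes its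
    default value 0 there. *)
Lemma frobmx_mul3 n (a b c : 'M[R]_n) : exists d,
  frobmx p (a *m b *m c) - frobmx p a *m frobmx p b *m frobmx p c = p%:R *: d.
Proof.
have [d1 ->] := frobmx_mul (a *m b) c; have [d2 ->] := frobmx_mul a b.
exists (d2 *m frobmx p c + d1).
by rewrite mulmxDl -scalemxAl addrC !addrA addNr add0r scalerDr.
Qed.

End FrobeniusModP.

Lemma map_frobmx (R S : comPzRingType) (f : {rmorphism R -> S}) (p n : nat)
    (a : 'M[R]_n) :
  map_mx f (frobmx p a) = frobmx p (map_mx f a).
Proof. by apply/matrixP => i j; rewrite !mxE rmorphXn. Qed.

Lemma trmx_frobmx (R : comPzRingType) (p n : nat) (a : 'M[R]_n) :
  (frobmx p a)^T = frobmx p a^T.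
Proof. by rewrite /frobmx map_trmx. Qed.

(** * Torsion-freeness and exact division by p *)

Definition torsion_free (R : pzRingType) (p : nat) :=
  forall a : R, p%:R * a = 0 -> a = 0.

Lemma torsion_free_inj (R : pzRingType) (p : nat) (a b : R) :
  torsion_free R p -> p%:R * a = p%:R * b -> a = b.
Proof.
by move=> tf ab; apply/eqP; rewrite -subr_eq0; apply/eqP/tf; rewrite mulrBr ab subrr.
Qed.

(** Torsion-freeness makes the quotient chosen by [divide_by_p] unique. *)
Lemma divide_by_pE (R : comPzRingType) (p : nat) (b : R) :
  torsion_free R p -> divide_by_p p (p%:R * b) = b.
Proof.
move=> tf; rewrite /divide_by_p; case: pselect => [h|[]]; last by exists b.
exact: (torsion_free_inj tf (projT2 (cid h))).
Qed.

(** If p u is null, then p^(m+1) divides p u_(m+1), so p^m divides u_(m+1). Since u is compatible,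
    p^m also divides u_m. Cancelling p costs one index, which compatibility gives back. *)
Lemma torsion_free_completion (R : comPzRingType) (p : nat) :
  torsion_free R p -> torsion_free (completion R p) p.
Proof.
move=> tf a; rewrite -(completion_reprK a); set u := completion_repr a.
rewrite mulr_natl -raddfMn -[RHS](raddf0 (@completion_pi R p)) /=.
move=> /(proj1 (completion_piP _ _)); rewrite subr0 => /asboolP hu.
rewrite -(raddf0 (@completion_pi R p)) /=; apply: (proj2 (completion_piP _ _)).
rewrite subr0; apply/asboolP => m.
have seq_ofMn : seq_of (u *+ p) m.+1 = p%:R * seq_of u m.+1.
  have -> : seq_of (u *+ p) = seq_of u *+ p by exact: (raddfMn val).
  by rewrite mulr_natl natmulfctE.
have [c] := hu m.+1; rewrite seq_ofMn subr0 exprS -mulrA.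
move=> /(torsion_free_inj tf) e.
have /asboolP/(_ m)[c' e'] := valP u.
by exists (c - c'); rewrite mulrBr -e -e' subr0 opprB addrC subrK.
Qed.

(** Before completion the ring lies in the fraction field of O[x], where p is still nonzero. *)
Lemma torsion_free_GLhat (O : idomainType) (p n : nat) :
  (p%:R : O) != 0 -> torsion_free (GLhat O p n) p.
Proof.
move=> p0; apply: torsion_free_completion => a /(congr1 val).
rewrite rmorphM rmorph_nat rmorph0 /= => /eqP; rewrite mulf_eq0 => /orP[|/eqP a0].
  rewrite -(rmorph_nat (@tofrac _)) tofrac_eq0 -(rmorph_nat (@mpolyC _ _)).
  by rewrite mpolyC_eq0 (negPf p0).
exact: val_inj.
Qed.

(* The inverse of 1 + a is the sum of the geometric series of - a. *)
Lemma adically_complete_unit1D (O : comUnitRingType) (a : O) :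
  is_adically_complete a -> (1 + a) \is a GRing.unit.
Proof.
move=> [separated complete].
pose u k := \sum_(i < k) (- a) ^+ i.
have uE k : (1 + a) * u k = 1 - (- a) ^+ k.
  by rewrite -[RHS]opprB subrX1 -mulNr opprB opprK.
have u_tail m d : exists c, u (m + d)%N - u m = a ^+ m * c.
  elim: d => [|d [c e]]; first by exists 0; rewrite addn0 subrr mulr0.
  exists (c + (-1) ^+ m * (- a) ^+ d).
  rewrite addnS /u big_ord_recr /= addrAC -/(u _) -/(u _) e mulrDr.
  by rewrite mulrA -exprMn mulrN1 -exprD.
have u_cauchy m i j : (m <= i)%N -> (m <= j)%N -> congr_mod (a ^+ m) (u i) (u j).
  move=> /subnKC<- /subnKC<-.
  have [[c e] [c' e']] := (u_tail m (i - m)%N, u_tail m (j - m)%N).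
  by exists (c - c'); rewrite mulrBr -e -e' opprB addrA subrK.
have [l l_lim] := complete u (fun m => ex_intro _ m (u_cauchy m)).
apply/unitrPr; exists l; apply/eqP; rewrite -subr_eq0; apply/eqP.
(* At index N + m the partial sum agrees with the limit modulo a^m, and its error term, a power of -
   a, is itself divisible by a^m. *)
apply: separated => m; have [N l_limN] := l_lim m.
have [c e] := l_limN (N + m)%N (leq_addr _ _).
exists (- (1 + a) * c - (-1) ^+ m * (- a) ^+ N).
rewrite mulrBr mulrCA -e mulrA -exprMn mulrN1 -exprD [(m + N)%N]addnC subr0.
by rewrite mulNr mulrBr uE; ring.
Qed.

(** As p is odd, 2 divides 1 + p, which is a unit by completeness. *)
Lemma complete_unit2 (O : comUnitRingType) (p : nat) :
  odd p -> is_adically_complete (p%:R : O) -> (2%:R : O) \is a GRing.unit.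
Proof.
move=> p_odd /adically_complete_unit1D.
rewrite -[1 + _](natrD _ 1 p) -[(1 + p)%N]odd_double_half /= p_odd add0n.
by rewrite -muln2 natrM unitrM => /andP[].
Qed.

(** * The ideal (p, x - 1) and evaluation at the identity matrix *)

Section Specialization.
Variables (O : idomainType) (p n : nat).

Local Notation A := (GLhat O p n).
Local Notation x := (xG O p n).
Local Notation X := (generic_poly_mx O n).
Local Notation cst := (@cstG O p n).

(** Evaluation is needed on polynomials only, since C_i comes from a matrix of polynomials.
    Flattening by [mxvec] matches the numbering of the variables. *)
Definition at_identity : {mpoly O[n * n]} -> O :=
  meval (mxvec (1%:M : 'M[O]_n) 0).

HB.instance Definition _ := GRing.RMorphism.on at_identity.

Lemma at_identityC (a : O) : at_identity a%:MP = a.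
Proof. exact: mevalC. Qed.

Lemma at_identity_X : map_mx at_identity X = 1%:M.
Proof.
by apply/matrixP => i j; rewrite !mxE /at_identity mevalXU mxvecE mxE.
Qed.

Lemma is_ideal_p_x1 : is_ideal (fun a : A => congr_mod_p_x1 a 0).
Proof.
split.
- exists 0, 0; rewrite mulr0 subrr add0r big1 // => i _.
  by rewrite big1 // => j _; rewrite mxE mul0r.
- move=> a b [c [d]]; rewrite subr0 => -> [c' [d']]; rewrite subr0 => ->.
  exists (c + c'), (d + d'); rewrite subr0 mulrDr addrACA; congr (_ + _).
  rewrite -big_split; apply: eq_bigr => i _; rewrite -big_split.
  by apply: eq_bigr => j _; rewrite [(d + d') i j]mxE mulrDl.
- move=> a b [c [d]]; rewrite subr0 => ->; exists (a * c), (a *: d).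
  rewrite subr0 mulrDr mulrCA mulr_sumr; congr (_ + _).
  apply: eq_bigr => i _; rewrite mulr_sumr; apply: eq_bigr => j _.
  by rewrite [(a *: d) i j]mxE mulrA.
Qed.

Lemma congr_mod_p_x1_sub (a b : A) :
  congr_mod_p_x1 a b <-> congr_mod_p_x1 (a - b) 0.
Proof. by split=> -[c [d e]]; exists c, d; move: e; rewrite subr0. Qed.

Lemma congr_mod_p_x1_refl (a : A) : congr_mod_p_x1 a a.
Proof. by apply/congr_mod_p_x1_sub; rewrite subrr; have [] := is_ideal_p_x1. Qed.

Lemma congr_mod_p_x1D (a b a' b' : A) :
  congr_mod_p_x1 a b -> congr_mod_p_x1 a' b' -> congr_mod_p_x1 (a + a') (b + b').
Proof.
have [_ addI _] := is_ideal_p_x1.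
move=> /congr_mod_p_x1_sub h /congr_mod_p_x1_sub h'; apply/congr_mod_p_x1_sub.
by rewrite opprD addrACA; apply: addI.
Qed.

Lemma congr_mod_p_x1_trans (a b c : A) :
  congr_mod_p_x1 a b -> congr_mod_p_x1 b c -> congr_mod_p_x1 a c.
Proof.
have [_ addI _] := is_ideal_p_x1.
move=> /congr_mod_p_x1_sub h /congr_mod_p_x1_sub h'; apply/congr_mod_p_x1_sub.
by rewrite -(subrKA b); apply: addI.
Qed.

Lemma congr_mod_p_x1M (a b a' b' : A) :
  congr_mod_p_x1 a b -> congr_mod_p_x1 a' b' -> congr_mod_p_x1 (a * a') (b * b').
Proof.
have [_ addI mulI] := is_ideal_p_x1.
move=> /congr_mod_p_x1_sub h /congr_mod_p_x1_sub h'; apply/congr_mod_p_x1_sub.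
have -> : a * a' - b * b' = a' * (a - b) + b * (a' - b') by ring.
by apply: addI; apply: mulI.
Qed.

Lemma congr_mod_p_x1_of_p (a b : A) : congr_mod p%:R a b -> congr_mod_p_x1 a b.
Proof.
move=> [c e]; exists c, 0; rewrite e big1 ?addr0 // => i _.
by rewrite big1 // => j _; rewrite mxE mul0r.
Qed.

Lemma xG_congr_1 (i j : 'I_n) : congr_mod_p_x1 (x i j) (1%:M i j).
Proof.
(* The elementary matrix selects the single generator (x - 1)_ij. *)
exists 0, (delta_mx i j); rewrite mulr0 add0r (bigD1 i) //= (bigD1 j) //=.
rewrite !big1 ?addr0.
- by rewrite [delta_mx _ _ _ _]mxE !eqxx mul1r !mxE.
- move=> k ki; rewrite big1 // => l _.
  by rewrite mxE (negPf ki) mul0r.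
- by move=> l lj; rewrite mxE eqxx (negPf lj) mul0r.
Qed.

(** Both sides are ring morphisms in f which agree on constants and, modulo (p, x - 1), on the
    variables; induction on f then propagates the congruence. *)
Lemma congr_at_identity (f : {mpoly O[n * n]}) :
  congr_mod_p_x1 (poly_to_GLhat p f) (cst (at_identity f)).
Proof.
pose ev : {rmorphism {mpoly O[n * n]} -> O} := at_identity.
have evC a : ev a%:MP = a by exact: at_identityC.
have evX : map_mx ev X = 1%:M by exact: at_identity_X.
(* From here on, only the values of [ev] on constants and variables are kept. *)
rewrite -[at_identity f]/(ev f); move: ev evC evX => ev evC evX.
elim/mpolyind: f => [|c m f _ _ IH].
  by rewrite !rmorph0; apply: congr_mod_p_x1_refl.
rewrite !rmorphD; apply: congr_mod_p_x1D IH.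
rewrite -mul_mpolyC !rmorphM evC; apply: congr_mod_p_x1M.
  exact: congr_mod_p_x1_refl.
rewrite mpolyXE_id !rmorph_prod.
elim: (index_enum _) => [|l s IH].
  by rewrite !big_nil; apply: congr_mod_p_x1_refl.
rewrite !big_cons; apply: congr_mod_p_x1M IH.
rewrite !rmorphXn; elim: (m l) => [|k IH].
  by rewrite !expr0; apply: congr_mod_p_x1_refl.
rewrite !exprS; apply: congr_mod_p_x1M IH.
case/mxvec_indexP: l => i j.
have -> : ev 'X_(mxvec_index i j) = (1%:M : 'M[O]_n) i j.
  by rewrite -evX !mxE.
have := xG_congr_1 i j; rewrite !mxE.
by case: (i == j); rewrite ?rmorph1 ?rmorph0.
Qed.

End Specialization.

(** * The metric condition and the matrices C_i *)

Lemma scalemx_torsion_free_inj (R : pzRingType) (p n : nat) (a b : 'M[R]_n) :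
  torsion_free R p -> p%:R *: a = p%:R *: b -> a = b.
Proof.
move=> tf /matrixP ab; apply/matrixP => i j; have := ab i j; rewrite !mxE.
exact: torsion_free_inj.
Qed.

(** Meant for c = p, F = x^(p), D = delta_i x, S = q^(p), T = delta q and S' = phi(q). Replacing S
    by S' - c T cancels F^T S' F, the only term without a factor c. *)
Lemma metric_expansion (R : comPzRingType) (n : nat) (c : R)
    (F D S S' T : 'M[R]_n) :
  S' = S + c *: T ->
  (F + c *: D)^T *m S' *m (F + c *: D) - F^T *m S *m F
  = c *: (F^T *m T *m F
          + (D^T *m S' *m F + F^T *m S' *m D + c *: (D^T *m S' *m D))).
Proof.
move=> S'E; have -> : S = S' - c *: T by rewrite S'E addrK.
rewrite [(F + _)^T]linearD /= [(c *: D)^T]linearZ /= !(mulmxDl, mulmxDr, mulmxN, mulNmx).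
rewrite !(=^~ scalemxAl, =^~ scalemxAr) !scalerDr.
(* With the products generalized, the identity is linear in five matrices and can be checked
   entrywise. *)
move: (F^T *m S' *m F) (F^T *m T *m F) (D^T *m S' *m F) => a t b.
move: (F^T *m S' *m D) (D^T *m S' *m D) => g h.
by apply/matrixP => i j; rewrite !mxE; ring.
Qed.

Section ConnectionMatrices.
Variables (O : idomainType) (p n : nat).
Hypotheses (p_pr : prime p) (p_neq0 : (p%:R : O) != 0).
Variables (delta : O -> O) (q : 'M[O]_n).

Local Notation A := (GLhat O p n).
Local Notation x := (xG O p n).
Local Notation X := (generic_poly_mx O n).
Local Notation cst := (@cstG O p n).
Local Notation "a ^(p)" := (frobmx p a) (at level 2, format "a ^(p)").

Lemma Cmx_poly :
  exists c : 'M[{mpoly O[n * n]}]_n,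
    Cmx p delta q = map_mx (@poly_to_GLhat O p n) c /\
    map_mx (@at_identity O n) c = - map_mx delta q.
Proof.
(* The division by p is carried out already over O[x]: [d] is the quotient of the bracket. *)
have [d d_def] := frobmx_mul3 p_pr X^T (map_mx (@mpolyC (n * n) O) q) X.
exists (- (X^(p)^T *m map_mx (@mpolyC (n * n) O \o delta) q *m X^(p)) + d).
split.
  rewrite map_mxD map_mxN !map_mxM /= -map_trmx map_frobmx -map_mx_comp.
  congr (_ + _).
  move: d_def => /(congr1 (map_mx (@poly_to_GLhat O p n))).
  rewrite map_mxB map_mxZ rmorph_nat !map_mxM /= !map_frobmx !map_mxM /=.
  rewrite -!map_trmx -map_mx_comp -trmx_frobmx => ->.
  apply/matrixP => i j; rewrite !mxE divide_by_pE //.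
  exact: torsion_free_GLhat.
have frob1 : (1%:M : 'M[O]_n)^(p) = 1%:M.
  apply/matrixP => i j; rewrite !mxE.
  by case: (i == j); rewrite ?expr1n // expr0n -(prednK (prime_gt0 p_pr)).
(* At x = 1 the equation for [d] reads q^(p) - q^(p) = p d(1), and p is nonzero in the domain O. *)
have d_at1 : map_mx (@at_identity O n) d = 0.
  move: d_def => /(congr1 (map_mx (@at_identity O n))).
  rewrite map_mxB map_mxZ rmorph_nat !map_mxM /= !map_frobmx !map_mxM /=.
  rewrite -!map_trmx at_identity_X trmx1 -map_mx_comp.
  rewrite frob1.
  rewrite !mul1mx !mulmx1 subrr => /matrixP d0.
  apply/matrixP => i j; have /esym/eqP := d0 i j.
  by rewrite !mxE mulf_eq0 (negPf p_neq0) => /eqP.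
rewrite map_mxD map_mxN d_at1 addr0 !map_mxM /= -map_trmx map_frobmx.
rewrite at_identity_X frob1 trmx1 mul1mx mulmx1 -map_mx_comp.
by congr (- _); apply/matrixP => i j; rewrite !mxE /= at_identityC.
Qed.

Lemma christoffel_sym_part (dG : A -> A) :
  q^T = q -> is_padic_connection delta dG -> is_metric delta q dG ->
  exists D, christoffel delta q dG + (christoffel delta q dG)^T + p%:R *: D
            = Cmx p delta q.
Proof.
move=> q_sym [[Phi_add Phi_mul _] dG_cst].
move=> [H [phi0 [[[H_add H_mul] _ _ Hx] [_ _ phi0x] Phi_H]]].
(* Packing phi^G and H as ring morphisms lets them pass through matrix products. *)
pose Phi : {rmorphism A -> A} := HB.pack (attached p dG)
  (GRing.isZmodMorphism.Build _ _ _ Phi_add)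
  (GRing.isMonoidMorphism.Build _ _ _ Phi_mul).
pose HM : {rmorphism A -> A} := HB.pack H
  (GRing.isZmodMorphism.Build _ _ _ H_add)
  (GRing.isMonoidMorphism.Build _ _ _ H_mul).
set Q := map_mx cst q in Hx.
pose F := x^(p); pose D := map_mx dG x; pose dq := map_mx (cst \o delta) q.
pose phiQ := map_mx (cst \o attached p delta) q.
have Phi_x : map_mx Phi x = F + p%:R *: D.
  by apply/matrixP => i j; rewrite !mxE.
have Phi_Q : map_mx Phi Q = phiQ.
  apply/matrixP => i j; rewrite !mxE /= /attached dG_cst.
  by rewrite rmorphD rmorphXn rmorphM rmorph_nat.
have phiQ_E : phiQ = Q^(p) + p%:R *: dq.
  apply/matrixP => i j; rewrite !mxE /= /attached.
  by rewrite rmorphD rmorphXn rmorphM rmorph_nat.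
have phiQ_sym : phiQ^T = phiQ by rewrite /phiQ map_trmx q_sym.
(* Apply phi^G H = H phi_0 to the entries of x: H sends x to x^T q x, and hence phi_0(x) = x^(p) to
   the p-th powers of its entries. *)
have metric_x : map_mx Phi (x^T *m Q *m x) = (x^T *m Q *m x)^(p).
  rewrite -Hx -(map_frobmx HM) -phi0x -!map_mx_comp.
  by apply/matrixP => i j; rewrite !mxE; apply: Phi_H.
have [d d_def] := frobmx_mul3 p_pr x^T Q x.
have CE : Cmx p delta q = - (F^T *m dq *m F) + d.
  congr (_ + _); rewrite trmx_frobmx d_def.
  apply/matrixP => i j; rewrite !mxE divide_by_pE //.
  exact: torsion_free_GLhat.
(* The second-order term of the expansion. The two first-order terms are Gamma and, by the symmetry
   of phi(q), its transpose. *)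
exists (D^T *m phiQ *m D); rewrite CE.
apply: (scalemx_torsion_free_inj (torsion_free_GLhat p_neq0)).
rewrite [RHS]scalerDr -d_def -metric_x !map_mxM /= -map_trmx Phi_x Phi_Q -trmx_frobmx -/F.
(* The term F^T (delta q) F of the expansion cancels the first summand of C. *)
rewrite [RHS]addrC (metric_expansion F D phiQ_E) -[RHS]scalerDr.
rewrite [X in _ = _ *: X]addrC addKr.
by rewrite /christoffel -/F -/D -/phiQ !trmx_mul trmxK phiQ_sym mulmxA.
Qed.

Lemma Cmx_congr (j k : 'I_n) :
  congr_mod_p_x1 (Cmx p delta q j k) (cst (- delta (q j k))).
Proof.
have [c [-> c_at1]] := Cmx_poly; rewrite mxE.
have /matrixP/(_ j k) := c_at1; rewrite !mxE => <-.
exact: congr_at_identity.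
Qed.

End ConnectionMatrices.

(** * Inverting the relation between the C_ijk and the Christoffel symbols *)

Lemma congr_mod_half_sum (R : comPzRingType) (d h a b c u v w : R) :
  h * 2%:R = 1 ->
  congr_mod d a (h * (a + b + d * u + (a + c + d * v) - (b + c + d * w))).
Proof.
move=> h2; exists (- h * (u + v - w)); rewrite -[X in X - _]mul1r -h2; ring.
Qed.

Theorem proposition2p19
  (p : nat) (O : idomainType) (n : nat)
  (p_prime : prime p) (p_odd : odd p)
  (O_dvr : is_DVR_with_maximal_ideal (p%:R : O))
  (O_complete : is_adically_complete (p%:R : O))
  (O_perfect : has_perfect_residue_field O p)
  (delta : O -> O) (delta_pder : is_p_derivation p delta)
  (n_ge1 : (1 <= n)%N)
  (q : 'I_n -> 'M[O]_n)
  (q_sym : forall i, ((q i)^T)%R = q i)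
  (q_GL : forall i, q i \in unitmx)
  (deltaG : 'I_n -> GLhat O p n -> GLhat O p n)
  (deltaG_LC : is_levi_civita delta q deltaG) :
  let Gamma (i : 'I_n) : 'M[GLhat O p n]_n :=
    christoffel delta (q i) (deltaG i) in
  let C (i : 'I_n) : 'M[GLhat O p n]_n := Cmx p delta (q i) in
  forall i j k : 'I_n,
    congr_mod p%:R (Gamma i j k)
      (cstG p n 2%:R^-1 * (C i j k + C j i k - C k i j)) /\
    congr_mod_p_x1 (Gamma i j k)
      (cstG p n (- 2%:R^-1
        * (delta (q i j k) + delta (q j i k) - delta (q k i j)))).
Proof.
move=> Gamma C i j k.
have p_neq0 : (p%:R : O) != 0 by have [_ /eqP] := O_dvr.
(* Makes [2%:R^-1] a true inverse rather than a default value. *)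
have unit2 := complete_unit2 p_odd O_complete.
have [conn metric torsionless] := deltaG_LC.
have sym_part l : exists D, Gamma l + (Gamma l)^T + p%:R *: D = C l.
  exact: christoffel_sym_part.
have CE l : exists D : 'M_n, forall r s,
    C l r s = Gamma l r s + Gamma l s r + p%:R * D r s.
  by have [D e] := sym_part l; exists D => r s; rewrite -e !mxE.
have Gamma_sym l r s : Gamma l r s = Gamma r l s by exact: torsionless.
have C_at1 l r s : congr_mod_p_x1 (C l r s) (cstG p n (- delta (q l r s))).
  exact: Cmx_congr.
clearbody Gamma C.
have [[[Di ei] [Dj ej]] [Dk ek]] := (CE i, CE j, CE k).
have Gamma_congr : congr_mod p%:R (Gamma i j k)
    (cstG p n 2%:R^-1 * (C i j k + C j i k - C k i j)).
  have half2 : @cstG O p n 2%:R^-1 * 2%:R = 1.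
    by rewrite -(rmorph_nat (@cstG O p n)) -rmorphM mulVr // rmorph1.
  (* The symmetry leaves three symbols: Gamma_ijk occurs twice with sign plus, while Gamma_ikj and
     Gamma_jki cancel. *)
  rewrite ei ej ek (Gamma_sym j i k) (Gamma_sym k i j) (Gamma_sym k j i).
  exact: congr_mod_half_sum.
split; first exact: Gamma_congr.
apply: (congr_mod_p_x1_trans (congr_mod_p_x1_of_p Gamma_congr)).
rewrite mulNr -mulrN rmorphM; apply: congr_mod_p_x1M.
  exact: congr_mod_p_x1_refl.
(* Differences become sums with a factor -1, so that compatibility of the congruence with sums and
   products suffices. *)
have -> : - (delta (q i j k) + delta (q j i k) - delta (q k i j))
    = - delta (q i j k) + - delta (q j i k) + -1 * - delta (q k i j) by ring.
rewrite -[- C k i j]mulN1r !rmorphD rmorphM rmorphN1.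
apply: congr_mod_p_x1D; first by apply: congr_mod_p_x1D; apply: C_at1.
apply: congr_mod_p_x1M; first exact: congr_mod_p_x1_refl.
exact: C_at1.
Qed.
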